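(* If $\omega\subseteq X\subseteq\beta\omega$ and $\operatorname{CL}(X)$ is pseudocompact, then $\operatorname{CL}(X)$ is $(\kappa,\omega^* )$-pseudocompact for every cardinal $\kappa<\mathfrak h$.
   Context: $\beta\omega$ is the Stone–Čech compactification of the discrete space $\omega$, $\omega^*$ the set of free ultrafilters on $\omega$. $\mathfrak h$ is the least cardinality of a family of open dense subsets of $([\omega]^\omega,\subseteq^* )$ with empty intersection (a family $\mathcal D\subseteq[\omega]^\omega$ is open dense if every $A\in[\omega]^\omega$ contains some $B\in\mathcal D$, and $\mathcal D$ is closed under infinite $\subseteq^*$-subsets). $\operatorname{CL}(X)$ is the set of nonempty closed subsets of $X$ with the Vietoris topology; pseudocompact means every continuous real-valued function is bounded. For $p\in\omega^*$ and a sequence $(B_n)$ of subsets of a space $Z$, $z$ is a $p$-limit of $(B_n)$ if $\{n:V\cap B_n\ne\emptyset\}\in p$ for every neighborhood $V$ of $z$; $Z$ is $(\kappa,\omega^* )$-pseudocompact if for every family $\{(V^\alpha_n:n\in\omega):\alpha<\kappa\}$ of sequences of nonempty open subsets of $Z$ there is a single $p\in\omega^*$ such that each $(V^\alpha_n:n\in\omega)$ has a $p$-limit point in $Z$. *)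

(* Defs.v *)
From Stdlib Require Import Reals List.
Open Scope R_scope.

Definition is_ultrafilter (p : (nat -> Prop) -> Prop) : Prop :=
  p (fun _ => True) /\
  ~ p (fun _ => False) /\
  (forall A B : nat -> Prop, p A -> (forall n, A n -> B n) -> p B) /\
  (forall A B : nat -> Prop, p A -> p B -> p (fun n => A n /\ B n)) /\
  (forall A : nat -> Prop, p A \/ p (fun n => ~ A n)).

Definition free_ultrafilter (p : (nat -> Prop) -> Prop) : Prop :=
  is_ultrafilter p /\ forall n : nat, ~ p (fun m => m = n).

(* the principal ultrafilter at n : this is how omega sits inside beta omega *)
Definition principal (n : nat) : (nat -> Prop) -> Prop := fun A => A n.

Definition pt := (nat -> Prop) -> Prop.   (* points of beta omega *)

(* open subsets of the subspace X of beta omega: the topology of beta omega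
   has basic open sets  A^ = {u | A \in u}, A subset of omega *)
Definition open_in (X : pt -> Prop) (U : pt -> Prop) : Prop :=
  (forall u, U u -> X u) /\
  forall u, U u -> exists A : nat -> Prop,
      u A /\ forall v, X v -> v A -> U v.

Definition closed_in (X : pt -> Prop) (F : pt -> Prop) : Prop :=
  (forall u, F u -> X u) /\ open_in X (fun u => X u /\ ~ F u).

Definition CL (X : pt -> Prop) (F : pt -> Prop) : Prop :=
  closed_in X F /\ exists u, F u.

Definition vietoris_basic (X : pt -> Prop) (Us : list (pt -> Prop))
    (F : pt -> Prop) : Prop :=
  CL X F /\
  (forall u, F u -> exists U, In U Us /\ U u) /\
  (forall U, In U Us -> exists u, F u /\ U u).

Definition vietoris_open (X : pt -> Prop) (W : (pt -> Prop) -> Prop) : Prop :=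
  (forall F, W F -> CL X F) /\
  forall F, W F -> exists Us : list (pt -> Prop),
      (forall U, In U Us -> open_in X U) /\
      vietoris_basic X Us F /\
      (forall G, vietoris_basic X Us G -> W G).

(* General notions for a space given by a carrier S and its open sets  *)
(* O (members of O are subsets of S).                                  *)

Definition continuous_on {T : Type} (S : T -> Prop) (O : (T -> Prop) -> Prop)
    (f : T -> R) : Prop :=
  forall z, S z -> forall eps, 0 < eps ->
    exists V, O V /\ V z /\ forall y, V y -> S y -> Rabs (f y - f z) < eps.

Definition pseudocompact {T : Type} (S : T -> Prop) (O : (T -> Prop) -> Prop)
  : Prop :=
  forall f : T -> R, continuous_on S O f ->
    exists M : R, forall z, S z -> Rabs (f z) <= M.

Definition p_limit {T : Type} (O : (T -> Prop) -> Prop)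
    (p : (nat -> Prop) -> Prop) (B : nat -> T -> Prop) (z : T) : Prop :=
  forall V, O V -> V z -> p (fun n => exists y, V y /\ B n y).

(* (kappa, omega^* )-pseudocompactness, where kappa = |I| *)
Definition kappa_wstar_pseudocompact {T : Type} (S : T -> Prop)
    (O : (T -> Prop) -> Prop) (I : Type) : Prop :=
  forall V : I -> nat -> T -> Prop,
    (forall a n, O (V a n) /\ exists y, V a n y) ->
    exists p, free_ultrafilter p /\
      forall a, exists z, S z /\ p_limit O p (V a) z.

Definition infinite (A : nat -> Prop) : Prop :=
  forall n, exists m, (n <= m)%nat /\ A m.

Definition subset_star (A B : nat -> Prop) : Prop :=
  exists n, forall m, (n <= m)%nat -> A m -> B m.

Definition open_dense (D : (nat -> Prop) -> Prop) : Prop :=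
  (forall B, D B -> infinite B) /\
  (forall A, infinite A -> exists B, D B /\ forall n, B n -> A n) /\
  (forall B C, D B -> infinite C -> subset_star C B -> D C).

(* |I| < h : since h is the least cardinality of a family of open dense
   subsets of [omega]^omega with empty intersection, |I| < h holds iff
   every I-indexed family of open dense sets has nonempty intersection. *)
Definition lt_h (I : Type) : Prop :=
  forall D : I -> (nat -> Prop) -> Prop,
    (forall i, open_dense (D i)) ->
    exists B, infinite B /\ forall i, D i B.

(* Main.v *)
(** Finite subsets of [omega] are isolated and dense in [CL X], so the given
    open sets may be replaced by finite sets [F^alpha_n].  Cut [omega] into
    consecutive finite blocks [[m_i, m_(i+1))].  Pseudocompactness makes the
    blocks accumulate at some [C] in [CL X]; since the blocks are disjoint, [C]
    determines a free ultrafilter [p] on the indices, and because [C] is an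
    accumulation point in the Vietoris topology, [p-lim a_i] lies in [X] for
    every selector [a] of the blocks at once.

    For fixed [alpha], the sets [B] along which [F^alpha_b] is, up to the
    preceding element of [B], equal to a fixed set [L_alpha], and is bounded by
    the next element of [B], form an open dense family.  Since [kappa < h], one
    [B] works for all [alpha].  Taking every other element of [B] as a block
    boundary, each [F^alpha_b] is, outside of [L_alpha], contained in a single
    block, so that the ultrafilter [p] of these blocks serves all [alpha]. *)
Require Import Defs.
From Stdlib Require Import Reals List.
From Stdlib Require Import Classical IndefiniteDescription FunctionalExtensionality
  PropExtensionality Lra Lia.

Lemma set_ext {T : Type} (P Q : T -> Prop) : (forall x, P x <-> Q x) -> P = Q.
Proof.
  intros H; apply functional_extensionality; intros x.
  now apply propositional_extensionality.
Qed.

(** * Ultrafilters on [omega] *)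

Section Ultrafilter.

Variables (p : pt) (Hp : is_ultrafilter p).

Lemma uf_mono (A B : nat -> Prop) : p A -> (forall n, A n -> B n) -> p B.
Proof. apply Hp. Qed.

Lemma uf_and (A B : nat -> Prop) : p A -> p B -> p (fun n => A n /\ B n).
Proof. apply Hp. Qed.

Lemma uf_all (A : nat -> Prop) : (forall n, A n) -> p A.
Proof. intros H; apply (uf_mono (fun _ => True)); [apply Hp | auto]. Qed.

Lemma uf_compl (A : nat -> Prop) : ~ p A -> p (fun n => ~ A n).
Proof. intros H; destruct Hp as (_ & _ & _ & _ & Hu); destruct (Hu A); tauto. Qed.

Lemma uf_inhabited (A : nat -> Prop) : p A -> exists n, A n.
Proof.
  intros HA; apply NNPP; intros H.
  apply (proj1 (proj2 Hp)), (uf_mono A); [exact HA | intros n Hn; apply H; eauto].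
Qed.

Lemma uf_not_both (A : nat -> Prop) : p A -> ~ p (fun n => ~ A n).
Proof.
  intros H1 H2; destruct (uf_inhabited _ (uf_and _ _ H1 H2)) as [n [Ha Hn]]; auto.
Qed.

Lemma uf_or (A B : nat -> Prop) : p (fun n => A n \/ B n) -> p A \/ p B.
Proof.
  intros H; destruct (classic (p A)) as [HA | HA]; [now left | right].
  apply (uf_mono _ _ (uf_and _ _ H (uf_compl _ HA))); tauto.
Qed.

Lemma uf_forall_in {T : Type} (l : list T) (Q : T -> nat -> Prop) :
  (forall x, In x l -> p (Q x)) -> p (fun n => forall x, In x l -> Q x n).
Proof.
  induction l as [| x l IH]; intros H.
  - apply uf_all; simpl; tauto.
  - apply (uf_mono (fun n => Q x n /\ forall y, In y l -> Q y n)).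
    + apply uf_and; [apply H; now left | apply IH; intros y Hy; apply H; now right].
    + intros n [H1 H2] y [<- | Hy]; auto.
Qed.

Lemma uf_forall_lt (N : nat) (Q : nat -> nat -> Prop) :
  (forall k, k < N -> p (Q k))%nat -> p (fun n => forall k, (k < N)%nat -> Q k n).
Proof.
  intros H; apply (uf_mono (fun n => forall k, In k (seq 0 N) -> Q k n)).
  - apply uf_forall_in; intros k Hk; apply H; apply in_seq in Hk; lia.
  - intros n Hn k Hk; apply Hn, in_seq; lia.
Qed.

Lemma uf_singleton (k : nat) : p (fun n => n = k) -> p = principal k.
Proof.
  intros H; apply set_ext; intros A; unfold principal; split.
  - intros HA; destruct (uf_inhabited _ (uf_and _ _ H HA)) as [n [-> Hn]]; auto.
  - intros HA; apply (uf_mono _ _ H); intros n ->; auto.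
Qed.

Lemma uf_finite (l : list nat) :
  p (fun n => In n l) -> exists k, In k l /\ p = principal k.
Proof.
  intros H; apply NNPP; intros Hn.
  assert (Hc : p (fun n => forall k, In k l -> n <> k)).
  { apply uf_forall_in; intros k Hk; apply uf_compl; intros Hs.
    apply Hn; exists k; split; auto using uf_singleton. }
  destruct (uf_inhabited _ (uf_and _ _ H Hc)) as [n [H1 H2]]; now apply (H2 n).
Qed.

End Ultrafilter.

Lemma free_ge (p : pt) (Hp : free_ultrafilter p) (N : nat) :
  p (fun n => (N <= n)%nat).
Proof.
  destruct Hp as [Hu Hf].
  apply (uf_mono p Hu (fun n => forall k, (k < N)%nat -> n <> k)).
  - apply uf_forall_lt; auto; intros k _; now apply uf_compl.
  - intros n H; destruct (Nat.le_gt_cases N n) as [| Hlt]; auto.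
    now destruct (H n Hlt).
Qed.

(** Injectivity preserves freeness: the preimage of a singleton has at most one point, so it is not
    in [p]. *)
Lemma pushforward_free (p : pt) (h : nat -> nat) :
  free_ultrafilter p -> (forall i j, h i = h j -> i = j) ->
  free_ultrafilter (fun E => p (fun i => E (h i))).
Proof.
  intros [Hu Hf] Hinj; split.
  - destruct Hu as (H1 & H2 & H3 & H4 & H5).
    split; [| split; [| split; [| split]]]; auto.
    intros A B HA HAB; apply (H3 _ _ HA); auto.
  - intros n Hn.
    destruct (uf_inhabited p Hu _ Hn) as [i Hi].
    apply (Hf i), (uf_mono p Hu _ _ Hn).
    intros j Hj; apply Hinj; congruence.
Qed.

(** * Increasing sequences of natural numbers *)

Lemma increasing_lt (e : nat -> nat) :
  (forall i, e i < e (S i))%nat -> forall i j, (i < j)%nat -> (e i < e j)%nat.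
Proof. intros H i j Hij; induction Hij; [apply H | specialize (H m); lia]. Qed.

Lemma increasing_le (e : nat -> nat) :
  (forall i, e i < e (S i))%nat -> forall i j, (i <= j)%nat -> (e i <= e j)%nat.
Proof. intros H i j Hij; induction Hij; [auto | specialize (H m); lia]. Qed.

Lemma increasing_id (e : nat -> nat) :
  (forall i, e i < e (S i))%nat -> forall i, (i <= e i)%nat.
Proof. intros H i; induction i; [lia | specialize (H i); lia]. Qed.

Lemma increasing_inj (e : nat -> nat) :
  (forall i, e i < e (S i))%nat -> forall i j, e i = e j -> i = j.
Proof.
  intros H i j Hij; destruct (Nat.lt_total i j) as [Hl | [Hl | Hl]]; auto;
    apply (increasing_lt e H) in Hl; lia.
Qed.

(** Dependent choice: a successor function is chosen once, with the junk value 0 off [P], and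
    iterated from a point of [P]. *)
Lemma increasing_chain (P : nat -> Prop) (R : nat -> nat -> Prop) :
  (exists a, P a) ->
  (forall a, P a -> exists b, P b /\ (a < b)%nat /\ R a b) ->
  exists e : nat -> nat,
    forall i, P (e i) /\ (e i < e (S i))%nat /\ R (e i) (e (S i)).
Proof.
  intros [a0 Ha0] H.
  destruct (functional_choice
    (fun a b => P a -> P b /\ (a < b)%nat /\ R a b)) as [s Hs].
  { intros a; destruct (classic (P a)) as [Ha | Ha].
    - destruct (H a Ha) as [b Hb]; exists b; auto.
    - exists 0%nat; tauto. }
  exists (fun i => Nat.iter i s a0).
  assert (HP : forall i, P (Nat.iter i s a0)).
  { intros i; induction i; simpl; auto; now apply Hs. }
  intros i; split; [apply HP | apply Hs, HP].
Qed.

Lemma infinite_enum (B : nat -> Prop) :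
  infinite B -> exists e : nat -> nat, forall i, B (e i) /\ (e i < e (S i))%nat.
Proof.
  intros HB.
  destruct (increasing_chain B (fun _ _ => True)) as [e He].
  - destruct (HB 0%nat) as [a [_ Ha]]; eauto.
  - intros a _; destruct (HB (S a)) as [b [Hab Hb]]; exists b; repeat split; auto.
  - exists e; intros i; split; apply He.
Qed.

Lemma increasing_infinite (e : nat -> nat) :
  (forall i, e i < e (S i))%nat -> infinite (fun n => exists i, n = e i).
Proof.
  intros He n; exists (e n); split; [now apply increasing_id | eauto].
Qed.

Lemma free_uf_chain (q : pt) (Hq : free_ultrafilter q)
    (A : nat -> Prop) (R : nat -> nat -> Prop) :
  q A -> (forall a, q (R a)) ->
  exists e : nat -> nat,
    (forall i, A (e i)) /\ (forall i, e i < e (S i))%nat /\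
    (forall i j, (i < j)%nat -> R (e i) (e j)).
Proof.
  intros HA HR.
  (* Each new element is related to every [a'] up to the current one, so that consecutive steps give
     [R] for all pairs. Such an element exists because finitely many sets of [q] have nonempty
     intersection. *)
  destruct (increasing_chain A
    (fun a b => forall a', (a' < S a)%nat -> R a' b)) as [e He].
  - apply (uf_inhabited q (proj1 Hq)), HA.
  - intros a _; apply (uf_inhabited q (proj1 Hq)).
    apply uf_and; [apply Hq | exact HA |].
    apply uf_and; [apply Hq | exact (free_ge q Hq (S a)) |].
    apply uf_forall_lt; [apply Hq | auto].
  - assert (Hinc : forall i, (e i < e (S i))%nat) by (intros i; apply He).
    exists e; repeat split; auto.
    + intros i; apply He.
    + intros i [| j] Hij; [lia |].
      destruct (He j) as (_ & _ & H); apply H.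
      assert (e i <= e j)%nat by (apply increasing_le; [auto | lia]); lia.
Qed.

(** * The hyperspace *)

Definition fin (S : list nat) : pt -> Prop :=
  fun u => exists k, In k S /\ u = principal k.

Lemma principal_inj (j k : nat) : principal j = principal k -> j = k.
Proof.
  intros H.
  assert (Hj : principal j (fun n => n = j)) by reflexivity.
  rewrite H in Hj; now symmetry.
Qed.

Lemma fin_principal (S : list nat) (k : nat) : fin S (principal k) <-> In k S.
Proof.
  split.
  - intros (j & Hj & Hjk); apply principal_inj in Hjk; now subst.
  - intros H; exists k; auto.
Qed.

Lemma list_of_bounded (Q : nat -> Prop) (N : nat) :
  exists S : list nat, forall k, In k S <-> (k < N)%nat /\ Q k.
Proof.
  induction N as [| N [S HS]].
  - exists nil; simpl; lia.
  - destruct (classic (Q N)) as [HN | HN].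
    + exists (N :: S); intros k; simpl; rewrite HS; split.
      * intros [<- | [H1 H2]]; split; auto; lia.
      * intros [H1 H2]; destruct (Nat.eq_dec N k); [now left | right; split; [lia | auto]].
    + exists S; intros k; rewrite HS; split; intros [H1 H2]; split; auto; try lia.
      destruct (Nat.eq_dec N k); [now subst | lia].
Qed.

Lemma vietoris_basic_open (X : pt -> Prop) (Us : list (pt -> Prop)) :
  (forall U, In U Us -> open_in X U) -> vietoris_open X (vietoris_basic X Us).
Proof.
  intros H; split.
  - intros F [HF _]; exact HF.
  - intros F HF; exists Us; auto.
Qed.

(** A locally constant function is continuous as a real-valued one. Pseudocompactness enters the
    proof only in this form. *)
Lemma locally_constant_bounded {T : Type} (S : T -> Prop) (O : (T -> Prop) -> Prop)
    (f : T -> nat) :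
  pseudocompact S O ->
  (forall z, S z -> exists V, O V /\ V z /\ forall y, V y -> S y -> f y = f z) ->
  exists M, forall z, S z -> (f z <= M)%nat.
Proof.
  intros Hpc Hf.
  destruct (Hpc (fun z => INR (f z))) as [M HM].
  - intros z Hz eps Heps; destruct (Hf z Hz) as (V & HO & HV & Hc).
    exists V; repeat split; auto.
    intros y Hy HSy; rewrite (Hc y Hy HSy), Rminus_diag, Rabs_R0; exact Heps.
  - destruct (INR_unbounded M) as [n Hn]; exists n; intros z Hz.
    apply INR_le; specialize (HM z Hz); pose proof (Rle_abs (INR (f z))); lra.
Qed.

Section Hyperspace.

Variable X : pt -> Prop.
Hypothesis HXbeta : forall u, X u -> is_ultrafilter u.
Hypothesis Homega : forall n : nat, X (principal n).

Lemma open_clopen (A : nat -> Prop) : open_in X (fun u => X u /\ u A).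
Proof.
  split; [tauto |].
  intros u [Hu HA]; exists A; auto.
Qed.

Lemma open_in_omega (U : pt -> Prop) (u : pt) :
  open_in X U -> U u -> u (fun k => U (principal k)).
Proof.
  intros [HUX HU] Hu; destruct (HU u Hu) as (A & HA & HAU).
  apply (uf_mono u (HXbeta u (HUX u Hu)) A); auto.
Qed.

(** An ultrafilter containing a finite set is principal at one of its elements; any other point of
    [X] thus has the complement of [S] as a neighborhood. *)
Lemma CL_fin (S : list nat) : S <> nil -> CL X (fin S).
Proof.
  intros HS; split; [split; [| split] |].
  - intros u (k & _ & ->); apply Homega.
  - tauto.
  - intros u [Hu Hn]; exists (fun k => ~ In k S); split.
    + apply uf_compl; auto; intros H; apply Hn, (uf_finite u); auto.
    + intros v Hv HvS; split; auto.
      intros (k & Hk & ->); now apply HvS.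
  - destruct S as [| k S]; [congruence |].
    exists (principal k); apply fin_principal; now left.
Qed.

(** The basic set given by the open singletons of the elements of [S] has only one member: the
    covering condition gives one inclusion, the meeting condition the other. *)
Lemma fin_isolated (S : list nat) :
  S <> nil -> vietoris_open X (fun F => F = fin S).
Proof.
  intros HS; split; [intros F ->; now apply CL_fin |].
  intros F ->.
  exists (map (fun k u => u = principal k) S); split; [| split].
  - intros U HU; apply in_map_iff in HU; destruct HU as (k & <- & Hk); split.
    + intros u ->; apply Homega.
    + intros u ->; exists (fun n => n = k); split; [reflexivity |].
      intros v Hv; now apply uf_singleton; apply HXbeta.
  - split; [now apply CL_fin |]; split.
    + intros u (k & Hk & ->); exists (fun u => u = principal k); split; auto.
      apply in_map_iff; eauto.
    + intros U HU; apply in_map_iff in HU; destruct HU as (k & <- & Hk).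
      exists (principal k); split; auto; now apply fin_principal.
  - intros G (_ & Hsub & Hmeet); apply set_ext; intros u; split.
    + intros Hu; destruct (Hsub u Hu) as (U & HU & HUu).
      apply in_map_iff in HU; destruct HU as (k & <- & Hk); exists k; auto.
    + intros (k & Hk & ->).
      destruct (Hmeet (fun u => u = principal k)) as (v & Hv & ->); auto.
      apply in_map_iff; eauto.
Qed.

Lemma fin_dense (W : (pt -> Prop) -> Prop) :
  vietoris_open X W -> (exists F, W F) -> exists S, S <> nil /\ W (fin S).
Proof.
  intros [_ HW] [F HF]; destruct (HW F HF) as (Us & Hop & HFb & HsubW).
  destruct HFb as ([[HFX _] [u0 Hu0]] & Hsub & Hmeet).
  (* One natural number is picked from each open set of the list, by density of omega in [X]. *)
  assert (Hpts : exists S,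
    (forall k, In k S -> exists U, In U Us /\ U (principal k)) /\
    (forall U, In U Us -> exists k, In k S /\ U (principal k))).
  { clear Hsub HsubW; induction Us as [| U Us IH].
    - exists nil; simpl; split; intros; tauto.
    - destruct IH as (S & H1 & H2).
      + intros; apply Hop; now right.
      + intros; apply Hmeet; now right.
      + destruct (Hmeet U (or_introl eq_refl)) as (u & HuF & HuU).
        assert (HU : open_in X U) by (apply Hop; now left).
        destruct (uf_inhabited u (HXbeta u (HFX u HuF)) _ (open_in_omega U u HU HuU))
          as [k Hk].
        exists (k :: S); split.
        * intros j [<- | Hj]; [exists U; simpl; auto |].
          destruct (H1 j Hj) as (U' & ? & ?); exists U'; simpl; auto.
        * intros U' [<- | HU']; [exists k; simpl; auto |].
          destruct (H2 U' HU') as (j & ? & ?); exists j; simpl; auto. }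
  destruct Hpts as (S & H1 & H2).
  assert (HS : S <> nil).
  { intros ->; destruct (Hsub u0 Hu0) as (U & HU & _).
    now destruct (H2 U HU) as (k & [] & _). }
  exists S; split; auto; apply HsubW; split; [now apply CL_fin |]; split.
  - intros u (k & Hk & ->); auto.
  - intros U HU; destruct (H2 U HU) as (k & Hk & HUk).
    exists (principal k); rewrite fin_principal; auto.
Qed.

(** * Limits of sequences of finite sets *)

Definition meets (S : list nat) (A : nat -> Prop) : Prop :=
  exists k, In k S /\ A k.

Lemma fin_p_limit (p : pt) (Hp : is_ultrafilter p) (F : nat -> list nat)
    (V : nat -> (pt -> Prop) -> Prop) :
  (forall n, F n <> nil) -> (forall n, V n (fin (F n))) ->
  (forall A, p (fun n => meets (F n) A) ->
     exists u, X u /\ u A /\ forall B, u B -> p (fun n => meets (F n) B)) ->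
  exists z, CL X z /\ p_limit (vietoris_open X) p V z.
Proof.
  intros HF HV Hlim.
  (* The limit consists of all points of [X] each of whose basic neighborhoods meets [p]-many of the
     finite sets. *)
  exists (fun u => X u /\ forall B, u B -> p (fun n => meets (F n) B)); split.
  { split; [split; [tauto | split; [tauto |]] |].
    - intros u [Hu Hnu].
      assert (HA : exists A, u A /\ ~ p (fun n => meets (F n) A)).
      { apply NNPP; intros H; apply Hnu; split; auto.
        intros B HB; apply NNPP; intros HpB; apply H; eauto. }
      destruct HA as (A & HuA & HpA); exists A; split; auto.
      intros v Hv HvA; split; auto; intros [_ H]; auto.
    - destruct (Hlim (fun _ => True)) as (u & Hu & _ & HuB); eauto.
      apply uf_all; auto; intros n; specialize (HF n).
      destruct (F n) as [| k l]; [congruence | exists k; simpl; auto]. }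
  intros W [_ HW] HWz; destruct (HW _ HWz) as (Us & Hop & (_ & Hsub & Hmeet) & HUW).
  assert (H1 : p (fun n => forall U, In U Us ->
                   meets (F n) (fun k => U (principal k)))).
  { apply uf_forall_in; auto; intros U HU.
    destruct (Hmeet U HU) as (u & [HuX Hup] & HuU).
    apply Hup, open_in_omega; auto. }
  (* If [p]-many [F n] left the union of [Us], the hypothesis would give a point of the limit set
     containing the uncovered numbers, although [Us] covers the limit set. *)
  assert (H2 : p (fun n => ~ meets (F n)
                   (fun k => ~ exists U, In U Us /\ U (principal k)))).
  { apply uf_compl; auto; intros H; destruct (Hlim _ H) as (u & Hu & HuA & Hup).
    destruct (Hsub u (conj Hu Hup)) as (U & HU & HUu).
    destruct (uf_inhabited u (HXbeta u Hu) _
      (uf_and u (HXbeta u Hu) _ _ HuA (open_in_omega U u (Hop U HU) HUu)))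
      as (k & Hk & HUk); eauto. }
  apply (uf_mono p Hp _ _ (uf_and p Hp _ _ H1 H2)).
  intros n [Hn1 Hn2]; exists (fin (F n)); split; auto.
  apply HUW; split; [now apply CL_fin |]; split.
  - intros u (k & Hk & ->); apply NNPP; intros H; apply Hn2; exists k; auto.
  - intros U HU; destruct (Hn1 U HU) as (k & Hk & HUk).
    exists (principal k); rewrite fin_principal; auto.
Qed.

(** * The ultrafilter of a sequence of blocks *)

Section Blocks.

Hypothesis Hpc : pseudocompact (CL X) (vietoris_open X).
Variable m : nat -> nat.
Hypothesis Hm : forall i, (m i < m (S i))%nat.

Definition in_block (i k : nat) : Prop := (m i <= k < m (S i))%nat.

Definition block (i : nat) : list nat := seq (m i) (m (S i) - m i).

Lemma block_spec (i k : nat) : In k (block i) <-> in_block i k.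
Proof. unfold block, in_block; rewrite in_seq; specialize (Hm i); lia. Qed.

Lemma block_nonempty (i : nat) : block i <> nil.
Proof.
  intros H; assert (Hi : In (m i) (block i)) by
    (apply block_spec; unfold in_block; specialize (Hm i); lia).
  rewrite H in Hi; exact Hi.
Qed.

Lemma in_block_unique (i j k : nat) : in_block i k -> in_block j k -> i = j.
Proof.
  unfold in_block; intros Hi Hj.
  destruct (Nat.lt_total i j) as [Hl | [Hl | Hl]]; auto;
    apply (increasing_le m Hm) in Hl; lia.
Qed.

Lemma fin_block_inj (i j : nat) : fin (block i) = fin (block j) -> i = j.
Proof.
  intros H; assert (Hi : in_block i (m i)) by
    (unfold in_block; specialize (Hm i); lia).
  apply (in_block_unique i j (m i)); auto.
  apply block_spec, fin_principal; rewrite <- H; now apply fin_principal, block_spec.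
Qed.

(** Two basic clopen sets suffice below; taking [B = A] gives the case of one. *)
Lemma blocks_have_cluster_point :
  exists C, CL X C /\
    forall A B : nat -> Prop,
      (forall u, C u -> u A \/ u B) ->
      (exists u, C u /\ u A) -> (exists u, C u /\ u B) ->
      forall N, exists i, (N <= i)%nat /\
        (forall k, in_block i k -> A k \/ B k) /\
        (exists k, in_block i k /\ A k) /\ (exists k, in_block i k /\ B k).
Proof.
  apply NNPP; intros Hnone.
  (* [f] sends the [i]-th block to [i] and every other closed set to 0. Without a cluster point it
     is locally constant, yet it is unbounded. *)
  destruct (functional_choice (fun (F : pt -> Prop) (n : nat) =>
    (forall i, F = fin (block i) -> n = i) /\
    ((forall i, F <> fin (block i)) -> n = 0%nat))) as [f Hf].
  { intros F; destruct (classic (exists i, F = fin (block i))) as [[i ->] | H].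
    - exists i; split; [intros j; apply fin_block_inj | intros H; now destruct (H i)].
    - exists 0%nat; split; auto; intros i Hi; destruct H; eauto. }
  destruct (locally_constant_bounded (CL X) (vietoris_open X) f Hpc) as [M HM].
  - intros C HC.
    destruct (classic (exists S, S <> nil /\ C = fin S)) as [(S & HS & ->) | Hinf].
    { exists (fun F => F = fin S); split; [now apply fin_isolated |].
      split; auto; intros F ->; auto. }
    assert (HAB : exists (A B : nat -> Prop) N,
      (forall u, C u -> u A \/ u B) /\
      (exists u, C u /\ u A) /\ (exists u, C u /\ u B) /\
      forall i, (N <= i)%nat -> ~ ((forall k, in_block i k -> A k \/ B k) /\
        (exists k, in_block i k /\ A k) /\ (exists k, in_block i k /\ B k))).
    { apply NNPP; intros H; apply Hnone; exists C; split; auto.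
      intros A B H1 H2 H3 N; apply NNPP; intros H4; apply H; exists A, B, N.
      repeat split; auto; intros i Hi Hb; apply H4; eauto. }
    destruct HAB as (A & B & N & Hcov & HCA & HCB & Hfew).
    assert (HCX : forall u, C u -> X u) by apply HC.
    (* Otherwise every point of [C] is principal below [m N], which makes [C] a finite set of
       naturals. *)
    assert (Hbig : exists u, C u /\ u (fun k => (m N <= k)%nat)).
    { apply NNPP; intros H.
      assert (Hsmall : forall u, C u -> exists k, (k < m N)%nat /\ u = principal k).
      { intros u Hu; destruct (uf_finite u (HXbeta u (HCX u Hu)) (seq 0 (m N)))
          as (k & Hk & ->).
        - apply NNPP; intros Hn; apply H; exists u; split; auto.
          apply (uf_mono u (HXbeta u (HCX u Hu)) _ _
                   (uf_compl u (HXbeta u (HCX u Hu)) _ Hn)).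
          intros k Hk; rewrite in_seq in Hk; lia.
        - exists k; rewrite in_seq in Hk; split; [lia | auto]. }
      destruct (list_of_bounded (fun k => C (principal k)) (m N)) as [S HS].
      apply Hinf; exists S.
      assert (HCS : C = fin S).
      { apply set_ext; intros u; split.
        - intros Hu; destruct (Hsmall u Hu) as (k & Hk & ->).
          apply fin_principal, HS; auto.
        - intros (k & Hk & ->); now apply HS. }
      split; auto; intros ->; destruct HC as [_ [u Hu]].
      rewrite HCS in Hu; destruct Hu as (k & [] & _). }
    pose (clopen := fun (E : nat -> Prop) (u : pt) => X u /\ u E).
    (* Meeting the third set forces a block to have index at least [N]. It is cut down to the union
       of [A] and [B] so that it does not enlarge what the neighborhood covers. *)
    exists (vietoris_basic X
      (clopen A :: clopen B ::
       clopen (fun k => (A k \/ B k) /\ (m N <= k)%nat) :: nil)).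
    split; [| split].
    + apply vietoris_basic_open; simpl.
      intros U [<- | [<- | [<- | []]]]; apply open_clopen.
    + split; auto; split.
      * intros u Hu; destruct (Hcov u Hu).
        -- exists (clopen A); unfold clopen; simpl; auto.
        -- exists (clopen B); unfold clopen; simpl; auto.
      * simpl; intros U [<- | [<- | [<- | []]]].
        -- destruct HCA as (u & ? & ?); exists u; unfold clopen; auto.
        -- destruct HCB as (u & ? & ?); exists u; unfold clopen; auto.
        -- destruct Hbig as (u & Hu & Hge); exists u; unfold clopen.
           split; [| split]; auto.
           apply uf_and; auto; apply (uf_mono u (HXbeta u (HCX u Hu)) (fun k => A k \/ B k)); auto.
           destruct (Hcov u Hu) as [HuA | HuB];
             [apply (uf_mono u (HXbeta u (HCX u Hu)) _ _ HuA)
             | apply (uf_mono u (HXbeta u (HCX u Hu)) _ _ HuB)]; auto.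
    + intros F (_ & Hsub & Hmeet) _.
      assert (HfC : f C = 0%nat).
      { apply Hf; intros i ->; apply Hinf; exists (block i); split; auto.
        apply block_nonempty. }
      rewrite HfC; apply Hf; intros i ->.
      assert (Hm' : forall E, In (clopen E)
        (clopen A :: clopen B ::
         clopen (fun k => (A k \/ B k) /\ (m N <= k)%nat) :: nil) ->
        exists k, in_block i k /\ E k).
      { intros E HE; destruct (Hmeet _ HE) as (u & (k & Hk & ->) & _ & HEk).
        exists k; split; [now apply block_spec | exact HEk]. }
      apply (Hfew i).
      * destruct (Hm' (fun k => (A k \/ B k) /\ (m N <= k)%nat)) as (k & Hk & _ & Hge);
          [simpl; auto |].
        destruct (Nat.le_gt_cases N i) as [| Hlt]; auto.
        apply (increasing_le m Hm) in Hlt; unfold in_block in Hk; lia.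
      * split; [| split; apply Hm'; simpl; auto].
        intros k Hk; destruct (Hsub (principal k)) as (U & HU & HUk).
        { now apply fin_principal, block_spec. }
        simpl in HU; destruct HU as [<- | [<- | [<- | []]]];
          destruct HUk as [_ HUk]; unfold principal in HUk; tauto.
  - specialize (HM (fin (block (S M))) (CL_fin _ (block_nonempty (S M)))).
    rewrite (proj1 (Hf _) (S M) eq_refl) in HM; lia.
Qed.

(** [p] consists of those [E] for which the union of the blocks indexed by [E] belongs to every
    point of the cluster point [C]. For a selector [a], some point of [C] contains the range of [a],
    and this point is the image of [p] under [a]. *)
Lemma block_ultrafilter :
  exists p, free_ultrafilter p /\
    forall a : nat -> nat, (forall i, in_block i (a i)) ->
      X (fun E => p (fun i => E (a i))).
Proof.
  destruct blocks_have_cluster_point as (C & [[HCX _] [u0 Hu0]] & Hacc).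
  assert (HCu : forall u, C u -> is_ultrafilter u) by auto.
  assert (Hone : forall A : nat -> Prop, (forall u, C u -> u A) ->
            forall N, exists i, (N <= i)%nat /\ forall k, in_block i k -> A k).
  { intros A HA N.
    assert (HCA : exists u, C u /\ u A) by (exists u0; split; [| apply HA]; exact Hu0).
    destruct (Hacc A A (fun u Hu => or_introl (HA u Hu)) HCA HCA N)
      as (i & Hi & Hk & _).
    exists i; split; auto; intros k Hik; destruct (Hk k Hik); auto. }
  assert (Hm_in : forall i, in_block i (m i)) by
    (intros i; unfold in_block; specialize (Hm i); lia).
  pose (T := fun (E : nat -> Prop) (k : nat) => exists i, E i /\ in_block i k).
  (* A block cannot meet both [T E] and its complement, hence neither can [C]. *)
  assert (Hdich : forall E, (forall u, C u -> u (T E)) \/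
                            (forall u, C u -> u (fun k => ~ T E k))).
  { intros E; apply NNPP; intros H.
    assert (H1 : exists u, C u /\ u (T E)).
    { apply NNPP; intros Hn; apply H; right; intros u Hu.
      apply uf_compl; auto; intros HT; apply Hn; eauto. }
    assert (H2 : exists u, C u /\ u (fun k => ~ T E k)).
    { apply NNPP; intros Hn; apply H; left; intros u Hu.
      apply NNPP; intros HT; apply Hn; exists u; split; auto.
      now apply uf_compl; auto. }
    destruct (Hacc (T E) (fun k => ~ T E k)) with (N := 0%nat)
      as (i & _ & _ & (k & Hk & j & Hj & Hjk) & (l & Hl & Hnl)); auto.
    - intros u Hu; apply uf_or; auto; apply uf_all; auto; intros; apply classic.
    - apply Hnl; exists i; split; auto.
      now rewrite (in_block_unique i j k Hk Hjk). }
  (* The other alternative would place a whole block outside the union of all blocks. *)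
  assert (HT : forall u, C u -> u (T (fun _ => True))).
  { destruct (Hdich (fun _ => True)) as [H | H]; auto.
    destruct (Hone _ H 0%nat) as (i & _ & Hi).
    destruct (Hi (m i) (Hm_in i)); exists i; auto. }
  pose (p := fun E : nat -> Prop => forall u, C u -> u (T E)).
  assert (Hp : is_ultrafilter p).
  { unfold p; split; [| split; [| split; [| split]]]; auto.
    - intros H; destruct (uf_inhabited u0 (HCu u0 Hu0) _ (H u0 Hu0)) as (k & i & [] & _).
    - intros A B HA HAB u Hu; apply (uf_mono u (HCu u Hu) _ _ (HA u Hu)).
      intros k (i & Hi & Hk); exists i; auto.
    - intros A B HA HB u Hu.
      apply (uf_mono u (HCu u Hu) _ _ (uf_and u (HCu u Hu) _ _ (HA u Hu) (HB u Hu))).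
      intros k [(i & Hi & Hik) (j & Hj & Hjk)]; exists i; split; auto.
      rewrite (in_block_unique i j k) in Hi |- *; auto.
    - intros E; destruct (Hdich E) as [H | H]; [now left | right].
      intros u Hu.
      apply (uf_mono u (HCu u Hu) _ _ (uf_and u (HCu u Hu) _ _ (HT u Hu) (H u Hu))).
      intros k [(i & _ & Hik) Hn]; exists i; split; auto.
      intros Hi; apply Hn; exists i; auto. }
  exists p; split; [split; auto |].
  (* If the singleton of [n] were in [p], some block of index greater than [n] would lie inside
     block [n]. *)
  - intros n Hn; destruct (Hone _ Hn (S n)) as (i & Hi & Hk).
    destruct (Hk (m i) (Hm_in i)) as (j & -> & Hj).
    pose proof (in_block_unique i n (m i) (Hm_in i) Hj); lia.
  - intros a Ha.
    (* Otherwise [C] would have a neighborhood avoiding the range of [a]. *)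
    assert (Hu : exists u, C u /\ u (fun k => exists i, k = a i)).
    { apply NNPP; intros H; destruct (Hone (fun k => ~ exists i, k = a i))
        with (N := 0%nat) as (i & _ & Hi).
      - intros u Hu; apply uf_compl; auto; intros Hr; apply H; eauto.
      - apply (Hi (a i)); eauto. }
    destruct Hu as (u & Hu & Hur).
    (* The range of [a] meets block [i] only in [a i]. The reverse inclusion follows by passing to
       complements. *)
    assert (Hinc : forall E : nat -> Prop, p (fun i => E (a i)) -> u E).
    { intros E HE; specialize (HE u Hu).
      apply (uf_mono u (HCu u Hu) _ _ (uf_and u (HCu u Hu) _ _ HE Hur)).
      intros k [(i & Hi & Hik) (j & ->)].
      now rewrite (in_block_unique i j (a j)) in Hi. }
    replace (fun E : nat -> Prop => p (fun i => E (a i))) with u; auto.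
    apply set_ext; intros E; split; [| apply Hinc].
    intros HE; apply NNPP; intros Hn.
    apply (uf_not_both u (HCu u Hu) E HE), Hinc.
    exact (uf_compl p Hp _ Hn).
Qed.

End Blocks.

End Hyperspace.

(** * The open dense families *)

(** [L] is the pointwise limit of the sets [F b] along [B]. The threshold [K] discards finitely many
    elements, as closure under almost inclusion requires. *)
Definition settles (F : nat -> list nat) (B : nat -> Prop) : Prop :=
  infinite B /\
  exists (L : nat -> Prop) (K : nat),
    forall a b, B a -> B b -> (K <= a < b)%nat ->
      (forall k, In k (F a) -> (k < b)%nat) /\
      (forall k, (k < a)%nat -> (In k (F b) <-> L k)).

Lemma list_bound (l : list nat) : exists N, forall k, In k l -> (k < N)%nat.
Proof.
  induction l as [| x l [N HN]].
  - exists 0%nat; simpl; tauto.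
  - exists (S (x + N)); intros k [<- | Hk]; [lia | specialize (HN k Hk); lia].
Qed.

(** For density, [q] is moved to a free ultrafilter [r] containing [A], and [L] is the [r]-limit of
    [F]. For each [a], the set of [b] related to [a] as required is in [r], so a chain inside [A]
    can be chosen. *)
Lemma settles_open_dense (F : nat -> list nat) :
  (exists q, free_ultrafilter q) -> open_dense (settles F).
Proof.
  intros [q Hq]; split; [| split].
  - intros B [HB _]; exact HB.
  - intros A HA; destruct (infinite_enum A HA) as [e He].
    assert (Hq' := pushforward_free q e Hq
      (increasing_inj e (fun i => proj2 (He i)))).
    set (r := fun E : nat -> Prop => q (fun i => E (e i))) in Hq'.
    assert (HrA : r A) by (apply (uf_all q (proj1 Hq)); intros i; apply He).
    clearbody r; clear q Hq e He.
    pose (L := fun k => r (fun n => In k (F n))).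
    destruct (free_uf_chain r Hq' A (fun a b =>
      (forall k, In k (F a) -> (k < b)%nat) /\
      (forall k, (k < a)%nat -> (In k (F b) <-> L k)))) as (s & HsA & Hs & HsR).
    + exact HrA.
    + intros a; apply (uf_and r (proj1 Hq')).
      * destruct (list_bound (F a)) as [N HN].
        apply (uf_mono r (proj1 Hq') _ _ (free_ge r Hq' N)).
        intros n Hn k Hk; specialize (HN k Hk); lia.
      * apply (uf_forall_lt r (proj1 Hq') a (fun k b => In k (F b) <-> L k)).
        intros k _; destruct (classic (L k)) as [HL | HL].
        -- apply (uf_mono r (proj1 Hq') _ _ HL); tauto.
        -- apply (uf_mono r (proj1 Hq') _ _ (uf_compl r (proj1 Hq') _ HL)); tauto.
    + exists (fun n => exists i, n = s i); split; [split |].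
      * now apply increasing_infinite.
      * exists L, 0%nat; intros a b [i ->] [j ->] [_ Hij]; apply HsR.
        destruct (Nat.le_gt_cases j i) as [Hji |]; auto.
        apply (increasing_le s Hs) in Hji; lia.
      * intros n [i ->]; auto.
  - intros B C (_ & L & K & HB) HC [N HN]; split; auto.
    (* Beyond [N], elements of [C] belong to [B]. *)
    exists L, (K + N)%nat; intros a b Ha Hb Hab.
    apply HB; [apply HN | apply HN |]; auto; lia.
Qed.

(** Block boundaries are the odd-indexed elements of [B], and the finite sets are taken at the
    even-indexed ones between them. If [A] meets [L], a common element is a limit point. Otherwise,
    for large [i], the part in [A] of the [i]-th finite set lies in block [i], and a selector
    through these parts converges along [p] to the desired point. *)
Lemma settles_limits (X : pt -> Prop) (Homega : forall n, X (principal n))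
    (F : nat -> list nat) (B : nat -> Prop) (e : nat -> nat) (p : pt) :
  settles F B -> (forall i, B (e i) /\ (e i < e (S i))%nat) ->
  free_ultrafilter p ->
  (forall a : nat -> nat,
     (forall i, in_block (fun i => e (2 * i + 1)%nat) i (a i)) ->
     X (fun E => p (fun i => E (a i)))) ->
  forall A, p (fun i => meets (F (e (2 * i + 2)%nat)) A) ->
    exists u, X u /\ u A /\
      forall E, u E -> p (fun i => meets (F (e (2 * i + 2)%nat)) E).
Proof.
  intros (_ & L & K & HBK) He Hp Hsel A HpA.
  assert (Hinc : forall i, (e i < e (S i))%nat) by (intros i; apply He).
  assert (HB : forall i k, (K <= i)%nat ->
    (In k (F (e (2 * i + 2)%nat)) -> (k < e (2 * i + 3)%nat)%nat) /\
    ((k < e (2 * i + 1)%nat)%nat -> (In k (F (e (2 * i + 2)%nat)) <-> L k))).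
  { intros i k Hi.
    assert (H1 := increasing_id e Hinc (2 * i + 1)%nat).
    assert (H2 := Hinc (2 * i + 1)%nat).
    assert (H3 := Hinc (2 * i + 2)%nat).
    replace (S (2 * i + 1)) with (2 * i + 2)%nat in H2 by lia.
    replace (S (2 * i + 2)) with (2 * i + 3)%nat in H3 by lia.
    split; apply HBK; try apply He; lia. }
  destruct (classic (exists k, L k /\ A k)) as [(k & HLk & HAk) | HLA].
  (* For [i] beyond [K + k + 1], the element [k] lies below the left end of block [i], where the
     finite set agrees with [L]. *)
  - exists (principal k); split; [apply Homega |]; split; [exact HAk |].
    intros E HE; apply (uf_mono p (proj1 Hp) _ _ (free_ge p Hp (K + k + 1))).
    intros i Hi; exists k; split; auto; apply HB; auto; [lia |].
    pose proof (increasing_id e Hinc (2 * i + 1)%nat); lia.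
  - destruct (functional_choice (fun i k =>
      in_block (fun i => e (2 * i + 1)%nat) i k /\
      ((K <= i)%nat -> meets (F (e (2 * i + 2)%nat)) A ->
       In k (F (e (2 * i + 2)%nat)) /\ A k))) as [a Ha].
    { intros i; unfold in_block; replace (2 * S i + 1)%nat with (2 * i + 3)%nat by lia.
      destruct (classic ((K <= i)%nat /\ meets (F (e (2 * i + 2)%nat)) A))
        as [[Hi (k & Hk & HAk)] | H].
      - exists k; repeat split; auto; [| now apply (HB i)].
        destruct (Nat.le_gt_cases (e (2 * i + 1)%nat) k) as [| Hlt]; auto.
        destruct HLA; exists k; split; auto; now apply (HB i k Hi).
      (* The left end of the block is a default; the set of such indices [i] is not in [p]. *)
      - exists (e (2 * i + 1)%nat); split; [| tauto].
        split; auto; apply increasing_lt; auto; lia. }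
    exists (fun E => p (fun i => E (a i))).
    assert (Hin : p (fun i => In (a i) (F (e (2 * i + 2)%nat)) /\ A (a i))).
    { apply (uf_mono p (proj1 Hp) _ _
        (uf_and p (proj1 Hp) _ _ (free_ge p Hp K) HpA)).
      intros i [Hi HiA]; now apply Ha. }
    split; [apply Hsel; intros i; apply Ha | split].
    + apply (uf_mono p (proj1 Hp) _ _ Hin); tauto.
    + intros E HE.
      apply (uf_mono p (proj1 Hp) _ _ (uf_and p (proj1 Hp) _ _ Hin HE)).
      intros i [[H1 _] H2]; exists (a i); auto.
Qed.

(** * One ultrafilter for all the sequences *)

Theorem theorem4p9
  (X : pt -> Prop)
  (HXbeta : forall u, X u -> is_ultrafilter u)
  (Homega : forall n : nat, X (principal n))
  (Hpc : pseudocompact (CL X) (vietoris_open X))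
  (I : Type) (HI : lt_h I) :
  kappa_wstar_pseudocompact (CL X) (vietoris_open X) I.
Proof.
  intros V HV.
  destruct (functional_choice (fun (an : I * nat) (S : list nat) =>
    S <> nil /\ V (fst an) (snd an) (fin S))) as [F' HF'].
  { intros [a n]; destruct (HV a n) as [HO Hex]; simpl.
    now apply (fin_dense X HXbeta Homega). }
  pose (F := fun a n => F' (a, n)).
  assert (HF0 : forall a n, F a n <> nil) by (intros a n; apply (HF' (a, n))).
  assert (HFV : forall a n, V a n (fin (F a n))) by (intros a n; apply (HF' (a, n))).
  clearbody F.
  destruct (HI (fun a => settles (F a))) as (B & HB & HFB).
  { intros a; apply settles_open_dense.
    (* Some free ultrafilter is needed here; the blocks consisting of single numbers supply one. *)
    destruct (block_ultrafilter X HXbeta Homega Hpc (fun i => i)) as (q & Hq & _);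
      [lia | eauto]. }
  destruct (infinite_enum B HB) as [e He].
  assert (Hinc : forall i, (e i < e (S i))%nat) by (intros i; apply He).
  destruct (block_ultrafilter X HXbeta Homega Hpc (fun i => e (2 * i + 1)%nat))
    as (p & Hp & Hsel).
  { intros i; apply increasing_lt; auto; lia. }
  (* [p] lives on the block indices; its image under [i] to [e (2 * i + 2)] lives on the indices of
     the given sequences and does not depend on [a]. *)
  assert (Hp' : free_ultrafilter (fun E => p (fun i => E (e (2 * i + 2)%nat)))).
  { apply (pushforward_free p (fun i => e (2 * i + 2)%nat) Hp).
    intros i j Hij; apply (increasing_inj e Hinc) in Hij; lia. }
  exists (fun E => p (fun i => E (e (2 * i + 2)%nat))); split; auto.
  intros a; apply (fin_p_limit X HXbeta Homega _ (proj1 Hp') (F a)); auto.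
  now apply (settles_limits X Homega (F a) B e p).
Qed.
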